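(* Let $A\subset\mathbb{Z}$ be a fixed finite nonempty set with characteristic function $\chi_A$, and let $1\leq p\leq\infty$ be fixed, with dual exponent $p'$. Then for all integers $k$ large enough depending on $|A|$, $$\|\chi_A^{(k)}\|_{l^p(\mathbb{Z})}\geq 2^{\,k-1-\frac{|A|-1}{2}\log_2 (2k)}\Big(\frac{\sqrt{|A|-1}}{7\pi e^{3/2}}\Big)^{|A|-1}(k+1)^{-\frac{1}{p'}}|A|^{\frac{1}{p}}.$$ Also, for all integers $k$ large enough depending on the size $|\partial_l A|$ of the left boundary of $A$, $$\|\chi_A^{(k+1)}\|_{l^p(\mathbb{Z})}\geq 2^{\,k-1-\frac{2|\partial_l A|-1}{2}\log_2 (2k)}\Big(\frac{\sqrt{2|\partial_l A|-1}}{7\pi e^{3/2}}\Big)^{2|\partial_l A|-1}(k+1)^{-\frac{1}{p'}}\big(2|\partial_l A|\big)^{\frac{1}{p}}.$$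
   Context: For $f:\mathbb{Z}\to\mathbb{R}$ and an integer $k\geq 1$, the discrete derivative (forward difference) of order $k$ is $f^{(k)}(n):=\sum_{j=0}^{k}\binom{k}{j}(-1)^{j}f(n+k-j)$, $n\in\mathbb{Z}$. The left boundary of $A\subset\mathbb{Z}$ is $\partial_l A:=\{n\in A: n-1\notin A\}$. The dual exponent $p'$ satisfies $\frac1p+\frac1{p'}=1$, with $1/\infty=0$. When $|A|=1$, the factor $0^0$ is read as $1$. *)

(* Defs.v *)
From HB Require Import structures.
From mathcomp Require Import all_boot all_order all_algebra.
From mathcomp Require Import finmap.
From mathcomp Require Import all_classical all_reals all_analysis.
Set Implicit Arguments.
Unset Strict Implicit.
Unset Printing Implicit Defensive.
Import Order.TTheory GRing.Theory Num.Theory.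
Import numFieldNormedType.Exports.

Local Open Scope classical_set_scope.
Local Open Scope fset_scope.
Local Open Scope ring_scope.

(* The library gives [nat], but not [int], its discrete sigma-algebra. *)
HB.instance Definition _ := isPointed.Build int 0.
HB.instance Definition _ := @isMeasurable.Build default_measure_display
  int discrete_measurable discrete_measurable0
  discrete_measurableC discrete_measurableU.

Definition fwd_diff (R : realType) (k : nat) (f : int -> R) (n : int) : R :=
  \sum_(0 <= j < k.+1) 'C(k, j)%:R * (-1) ^+ j * f (n + k%:Z - j%:Z).

Definition char_fun (R : realType) (A : {fset int}) : int -> R :=
  \1_([set` A]).

Definition left_boundary (A : {fset int}) : {fset int} :=
  [fset n in A | n - 1 \notin A].

Definition lp_norm (R : realType) (p : \bar R) (f : int -> R) : \bar R :=
  Lnorm (@counting int R) p (EFin \o f).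

Definition log2 (R : realType) (x : R) : R := ln x / ln 2.

(* The lower bound at size [m]. The inverses of [p] and of its dual exponent are
   taken in [\bar R], where [+oo^-1 = 0]; they are finite when [1 <= p].
   The truncated exponent [m.-1] is only meant for [0 < m]; at [m = 1] the
   factor is [0 ^+ 0 = 1]. *)
Definition diff_lower_bound (R : realType) (p : \bar R) (m k : nat) : R :=
  2 `^ (k%:R - 1 - (m%:R - 1) / 2 * log2 (2 * k%:R))
  * (Num.sqrt (m%:R - 1) / (7 * pi * expR (3 / 2))) ^+ m.-1
  * (k%:R + 1) `^ (- fine (hoelder_conjugate p)^-1%E)
  * m%:R `^ fine p^-1%E.

(* Main.v *)
Require Import Defs.
From mathcomp Require Import all_boot all_order all_algebra.
From mathcomp Require Import finmap.
From mathcomp Require Import all_classical all_reals all_analysis.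
From mathcomp Require Import ess_sup_inf complex.
From mathcomp Require Import ring lra zify.
Import Order.TTheory GRing.Theory Num.Theory.
Import numFieldNormedType.Exports.

Local Open Scope classical_set_scope.
Local Open Scope fset_scope.
Local Open Scope ring_scope.

(** Both inequalities are one statement about a function [b] supported on a
    finite set [B] of [m = M + 1] integers and taking there some value of
    modulus at least [1]: the characteristic function of [A] for the first, its
    first difference, which is [1] or [-1] at exactly [2 |left_boundary A|]
    points, for the second ([fwd_diff_lp_ge]).

    Let [F(t) = sum_B b(n) e^(int)]. The difference of order [k] multiplies [F]
    by a factor of modulus [|e^(-it) - 1|^k], which is almost [2^k] for [t]
    within about [sqrt (M / k)] of [pi] ([exp_sum_fwd_diff] and
    [norm_cis_sub1_near_pi]). So the [l^1] norm of the difference is large as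
    soon as [F] is not too small near [pi].

    Averaging [F] over roots of unity of large order gives an angle [t] in
    [[0, 2 pi]] with [|F(t)| >= 1] ([exp_sum_ge_coef]). This largeness is moved
    to the neighbourhood of [pi] by an interpolation argument in the style of
    Turan. Put [h = (pi - t) / (L + 1)], so that the progression [t + j h]
    reaches [pi] after [L + 1] steps. Newton interpolation provides
    coefficients [c_i], [i <= M], of controlled [l^1] norm, such that
    [sum_i c_i z^(L+1+i) = 1] at the [m] unimodular numbers [z = e^(inh)],
    [n] in [B] ([unit_interpolation]); hence
    [F(t) = sum_i c_i F(pi + i h)]. The bound on the [c_i] depends on [L] and
    [m] only, not on how [B] is spread out, and this is why the threshold for
    [k] depends on the cardinality alone.

    Choosing [L] close to [2 sqrt (k M)] balances the loss
    [|e^(-it) - 1|^k / 2^k >= e^(-M)] against the size of the [c_i], which is of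
    order [(2 L)^M / M!] ([frequency_step_exists]). The factor [m] asked of the
    [l^1] norm is paid by [m <= 2^M] out of the generous constant [7 pi].

    Finally the difference of order [k] is supported on at most [(k + 1) m]
    integers, and Hoelder's inequality turns the [l^1] bound into an [l^p] bound
    at the cost of [((k + 1) m)^(1/p')] ([l1_le_lp_norm]). *)

(** * Interpolation of a negative power at unimodular numbers *)

(** The [l^1] norm that Newton interpolation of [z^-(L+1)] at [m] points of the
    unit circle can cost: the divided difference on [i + 1] points is a complete
    homogeneous sum with ['C(L + i, i)] unimodular terms, and the Newton
    polynomial of degree [i] it multiplies has [l^1] norm at most [2 ^ i]. *)
Definition turan_bound (L m : nat) : nat := \sum_(i < m) 'C(L + i, i) * 2 ^ i.

(** The recursion matching one step of Newton interpolation; it is the hockey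
    stick identity applied termwise. *)
Lemma turan_bound_rec (L m : nat) :
  (turan_bound L m.+1 = 1 + 2 * \sum_(a < L.+1) turan_bound a m)%N.
Proof.
rewrite /turan_bound exchange_big /= big_ord_recl /= bin0 expn0 muln1.
congr (_ + _)%N; rewrite big_distrr /=; apply: eq_bigr => i _.
rewrite -big_distrl /= /bump /= add1n expnS.
suff -> : ('C(L + i.+1, i.+1) = \sum_(a < L.+1) 'C(a + i, i))%N by rewrite mulnCA.
elim: L => [|L IH]; first by rewrite big_ord1 !add0n !binn.
by rewrite big_ord_recr /= -IH addSn binS addSnnS.
Qed.

(** One adds a node [y] by writing [z^-(L+1)] as [y^-(L+1)] plus a multiple of
    [z - y]. At the remaining nodes the cofactor is the quotient
    [(z^-(L+1) - y^-(L+1)) / (z - y)], a sum with unimodular coefficients of the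
    powers [z^-(a+1)], [a <= L], so it is interpolated by combining the
    interpolants of these powers. The nodes may coincide: no division by a
    difference of nodes takes place. *)
Lemma unit_interpolation (C : numFieldType) (zs : seq C) (L : nat) :
  (forall z, z \in zs -> `|z| = 1) ->
  exists Q : {poly C},
    [/\ (size Q <= size zs)%N,
        forall z, z \in zs -> Q.[z] * z ^+ L.+1 = 1
      & \sum_(i < size zs) `|Q`_i| <= (turan_bound L (size zs))%:R].
Proof.
elim: zs L => [|y zs IH] L unit_zs.
  by exists 0; split => //; rewrite ?size_poly0 // /turan_bound !big_ord0.
have y1 : `|y| = 1 by apply: unit_zs; rewrite mem_head.
have y0 : y != 0 by rewrite -normr_eq0 y1 oner_eq0.
have {}unit_zs z : z \in zs -> `|z| = 1.
  by move=> zzs; apply: unit_zs; rewrite in_cons zzs orbT.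
pose Qex a := cid (IH a unit_zs).
pose Q a := sval (Qex a).
have QS a : (size (Q a) <= size zs)%N by rewrite /Q; case: (Qex a) => ? [].
have QE a z : z \in zs -> (Q a).[z] * z ^+ a.+1 = 1.
  by rewrite /Q; case: (Qex a) => q [_ Qz _] /=; exact: Qz.
have QB a : \sum_(i < size zs) `|(Q a)`_i| <= (turan_bound a (size zs))%:R.
  by rewrite /Q; case: (Qex a) => ? [].
pose R := \sum_(a < L.+1) (y^-1 ^+ (L.+1 - a)) *: Q a.
have RS : (size R <= size zs)%N.
  apply: (big_ind (fun p : {poly C} => size p <= size zs)%N).
  - by rewrite size_poly0.
  - by move=> p q hp hq; apply: leq_trans (size_polyD _ _) _; rewrite geq_max hp.
  - by move=> a _; apply: leq_trans (size_scale_leq _ _) _.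
have RB : \sum_(i < size zs) `|R`_i| <= (\sum_(a < L.+1) turan_bound a (size zs))%:R.
  rewrite natr_sum; apply: (@le_trans _ _
    (\sum_(i < size zs) \sum_(a < L.+1) `|(Q a)`_i|)).
    apply: ler_sum => i _; rewrite coef_sum.
    apply: le_trans (ler_norm_sum _ _ _) _; apply: ler_sum => a _.
    by rewrite coefZ normrM normrX normfV y1 invr1 expr1n mul1r.
  by rewrite exchange_big /=; apply: ler_sum.
(* The minus sign comes from [1/z - 1/y = - (z - y) / (y z)]. *)
exists ((y^-1 ^+ L.+1)%:P - ('X - y%:P) * R); split.
- rewrite /=; apply: leq_trans (size_polyD _ _) _.
  rewrite geq_max (leq_trans (size_polyC_leq1 _)) //= size_polyN.
  apply: leq_trans (size_polyMleq _ _) _.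
  by rewrite size_XsubC /=.
- move=> z; rewrite in_cons => /predU1P[->|zzs].
    rewrite !hornerE subrr mul0r subr0 -exprMn mulVf ?expr1n //.
  have z0 : z != 0 by rewrite -normr_eq0 unit_zs // oner_eq0.
  have QV a : (Q a).[z] = z^-1 ^+ a.+1.
    apply: (mulIf (x := z ^+ a.+1)); first by rewrite expf_neq0.
    by rewrite QE // -exprMn mulVf // expr1n.
  suff -> : ((y^-1 ^+ L.+1)%:P - ('X - y%:P) * R).[z] = z^-1 ^+ L.+1.
    by rewrite -exprMn mulVf // expr1n.
  rewrite !hornerE horner_sum.
  under eq_bigr do rewrite hornerZ QV.
  have tele : z^-1 ^+ L.+1 - y^-1 ^+ L.+1 =
     (z^-1 - y^-1) * \sum_(a < L.+1) z^-1 ^+ a * y^-1 ^+ (L - a).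
    rewrite subrXX /=; congr (_ * _).
    rewrite (reindex_inj rev_ord_inj) /=; apply: eq_bigr => a _.
    by rewrite subSS subKn // -ltnS.
  have -> : \sum_(i < L.+1) y^-1 ^+ (L.+1 - i) * z^-1 ^+ i.+1 =
     y^-1 * z^-1 * \sum_(a < L.+1) z^-1 ^+ a * y^-1 ^+ (L - a).
    rewrite mulr_sumr; apply: eq_bigr => a _.
    by rewrite subSn -1?ltnS // !exprS; ring.
  rewrite -(subrK (y^-1 ^+ L.+1) (z^-1 ^+ L.+1)) tele.
  field.
  by rewrite y0.
- rewrite turan_bound_rec.
  rewrite /= natrD natrM.
  apply: (@le_trans _ _ (\sum_(i < (size zs).+1)
     (`|(y^-1 ^+ L.+1)%:P`_i| + (`|('X * R)`_i| + `|y * R`_i|)))).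
    apply: ler_sum => i _.
    rewrite mulrBl !coefB coefCM (le_trans (ler_normB _ _)) // lerD2l.
    exact: ler_normB.
  rewrite !big_split /=; apply: lerD.
    rewrite big_ord_recl /= coefC eqxx normrX normfV y1 invr1 expr1n.
    rewrite big1 ?addr0 // => i _.
    by rewrite coefC /= normr0.
  rewrite mulr_natl mulr2n; apply: lerD.
    rewrite big_ord_recl /= coefXM eqxx normr0 add0r.
    apply: le_trans RB; apply: ler_sum => i _.
    by rewrite coefXM /=.
  rewrite big_ord_recr /= (nth_default _ RS) mulr0 normr0.
  rewrite addr0; apply: le_trans RB; apply: ler_sum => i _.
  by rewrite normrM y1 mul1r.
Qed.

(** * Points of the unit circle *)

Definition cis {R : realType} (x : R) : R[i] := Complex (cos x) (sin x).

Lemma cis0 (R : realType) : cis (0 : R) = 1.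
Proof. by rewrite /cis cos0 sin0. Qed.

Lemma cisD (R : realType) (x y : R) : cis (x + y) = cis x * cis y.
Proof. by apply/eqP; rewrite eq_complex /= cosD sinD addrC (addrC (sin x * _)) !eqxx. Qed.

Lemma norm_cis (R : realType) (x : R) : `|cis x| = 1.
Proof. by rewrite normc_def /= cos2Dsin2 sqrtr1. Qed.

Lemma cisMn (R : realType) (x : R) n : cis (x * n%:R) = cis x ^+ n.
Proof.
elim: n => [|n IH]; first by rewrite mulr0 cis0.
by rewrite -natr1 mulrDr mulr1 cisD IH exprSr.
Qed.

Lemma norm_cis_sub1 (R : realType) (x : R) :
  `|cis x - 1| = real_complex R (Num.sqrt (2 - 2 * cos x)).
Proof.
rewrite normc_def /= subr0; congr (real_complex _ (Num.sqrt _)).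
have := cos2Dsin2 x; rewrite sqrrB1 => h.
by rewrite -mulr_natl; lra.
Qed.

Lemma sin_norm_le (R : realType) (x : R) : `|sin x| <= `|x|.
Proof.
wlog x0 : x / 0 <= x.
  move=> h; have [/h//|x0] := leP 0 x.
  by have := h (- x); rewrite sinN !normrN; apply; rewrite oppr_ge0 ltW.
have sin' (y : R) : y \in `]0, x[ -> is_derive y 1 sin (cos y) by move=> _; apply: is_derive_sin.
have [y _] := MVT_segment x0 sin' (continuous_subspaceT (@continuous_sin R)).
rewrite sin0 !subr0 => ->.
by rewrite normrM ler_piMl // cos_max.
Qed.

Lemma cos_ge (R : realType) (x : R) : 1 - x ^+ 2 / 2 <= cos x.
Proof.
have [y ->] : exists y, x = y *+ 2 by exists (x / 2); rewrite -(mulr_natr (x / 2)) divfK.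
rewrite cos_mulr2n cos2sin2.
have := sin_norm_le R y.
rewrite -(ler_pXn2r (n := 2)) ?nnegrE // !real_normK ?num_real //.
move: (sin y) => s h; rewrite (mulr2n y) (mulr2n (1 - s ^+ 2)); lra.
Qed.

Lemma cis_neq1 (R : realType) (x : R) : 0 < x < 2 * pi -> cis x != 1.
Proof.
move=> /andP[x0 x2]; rewrite eq_complex /= negb_and.
have : 0 < sin (x / 2).
  by apply: sin_gt0_pi; rewrite divr_gt0 //= ltr_pdivrMr // mulrC.
have -> : cos x = cos ((x / 2) *+ 2) by rewrite -(mulr_natr (x / 2)) divfK.
rewrite cos_mulr2n cos2sin2 => /(exprn_gt0 2).
move: (_ ^+ 2) => s s0; apply/orP; left.
by rewrite lt_eqF // (mulr2n (1 - s)); lra.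
Qed.

(** * Exponential sums and their differences *)

Definition exp_sum {R : realType} (B : seq int) (b : int -> R) (t : R) : R[i] :=
  \sum_(n <- B) real_complex R (b n) * cis (t * n%:~R).

Lemma exp_sum_shift (R : realType) (B S : seq int) (b : int -> R) (d : int) (t : R) :
    uniq B -> uniq S -> (forall n, n \notin B -> b n = 0) ->
    (forall n, n \in B -> n - d \in S) ->
  exp_sum S (fun n => b (n + d)) t = cis (- t * d%:~R) * exp_sum B b t.
Proof.
move=> uB uS b0 BS; rewrite /exp_sum (bigID (fun n => n + d \in B)) /=.
rewrite [X in _ + X]big1 ?addr0; last by move=> n /b0 ->; rewrite mul0r.
rewrite -big_filter (perm_big [seq n - d | n <- B]) /=; last first.
  apply: uniq_perm; first exact: filter_uniq.
    by rewrite map_inj_uniq // => x y; lia.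
  move=> n; rewrite mem_filter; apply/andP/mapP => [[nB nS]|[m mB ->]].
    by exists (n + d) => //; rewrite addrK.
  by rewrite subrK mB BS.
rewrite big_map mulr_sumr; apply: eq_bigr => n _.
rewrite subrK mulrCA -cisD; congr (_ * cis _).
by rewrite intrB; ring.
Qed.

(** A shift of the function multiplies its exponential sum by a unimodular
    factor, so the binomial sum defining the difference becomes a [k]-th power.
    [S] is any set large enough to contain the support of the difference. *)
Lemma exp_sum_fwd_diff (R : realType) (B S : seq int) (b : int -> R) (k : nat) (t : R) :
    uniq B -> uniq S -> (forall n, n \notin B -> b n = 0) ->
    (forall n j, n \in B -> (j <= k)%N -> n - k%:Z + j%:Z \in S) ->
  exp_sum S (fwd_diff k b) t = (cis (- t) - 1) ^+ k * exp_sum B b t.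
Proof.
move=> uB uS b0 BS; rewrite exprBn mulr_suml {1}/exp_sum.
under eq_bigr do rewrite /fwd_diff rmorph_sum mulr_suml.
rewrite exchange_big /= big_mkord; apply: eq_bigr => j _.
have jk : (j <= k)%N by rewrite -ltnS.
transitivity (real_complex R ('C(k, j)%:R * (-1) ^+ j)
   * exp_sum S (fun n => b (n + (k%:Z - j%:Z))) t).
  rewrite /exp_sum mulr_sumr; apply: eq_bigr => n _.
  by rewrite addrA rmorphM mulrA.
rewrite (@exp_sum_shift _ B) //; last first.
  by move=> n nB; rewrite opprB addrA addrAC BS.
rewrite expr1n mulr1 mulrA; congr (_ * _).
have -> : real_complex R ('C(k, j)%:R * (-1) ^+ j) = 'C(k, j)%:R * (-1) ^+ j.
  by rewrite (rmorphM (real_complex R)) /= rmorphXn /= rmorphN1 rmorph_nat.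
rewrite -mulrA mulr_natl; congr (_ * _ *+ _).
by rewrite -cisMn natrB // intrB.
Qed.

Lemma exp_sum_norm_le (R : realType) (S : seq int) (b : int -> R) (t : R) :
  `|exp_sum S b t| <= real_complex R (\sum_(n <- S) `|b n|).
Proof.
rewrite (le_trans (ler_norm_sum _ _ _)) // rmorph_sum; apply: ler_sum => n _.
by rewrite normrM norm_cis mulr1 normc_def /= expr0n addr0 sqrtr_sqr.
Qed.

(** [2 pi d / N] lies strictly between [0] and [2 pi] in absolute value, so the
    sum is geometric with ratio other than [1]. *)
Lemma sum_cis_roots (R : realType) (N : nat) (d : int) : d != 0 -> (`|d| < N)%N ->
  \sum_(j < N) cis (2 * pi * j%:R / N%:R * d%:~R : R) = 0.
Proof.
move=> d0 dN; have N0 : (N%:R : R) != 0 by rewrite pnatr_eq0; lia.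
have [e Ee] : exists e : R, e = 2 * pi * d%:~R / N%:R by eexists.
have -> : \sum_(j < N) cis (2 * pi * j%:R / N%:R * d%:~R : R) =
    \sum_(j < N) cis e ^+ j.
  by apply: eq_bigr => j _; rewrite -cisMn Ee; congr cis; field.
have cis2pi (m : nat) : cis (2 * pi * m%:R : R) = 1.
  by rewrite cisMn (_ : 2 * pi = pi *+ 2) ?mulr_natl // /cis cos2pi sin2pi expr1n.
have eN1 : cis e != 1.
  have : cis (2 * pi * `|d|%N%:R / N%:R : R) != 1.
    apply: cis_neq1; rewrite divr_gt0 ?mulr_gt0 ?pi_gt0 ?ltr0n ?absz_gt0 //; last lia.
    rewrite -mulrA gtr_pMr ?mulr_gt0 ?pi_gt0 // ltr_pdivrMr ?ltr0n; last lia.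
    by rewrite mul1r ltr_nat.
  rewrite Ee; have [d_ge0|d_lt0] := leP 0 d.
    by rewrite -{2}(gez0_abs d_ge0).
  apply: contra => /eqP ce; apply/eqP.
  have := cisD R e (- e); rewrite subrr cis0 Ee ce mul1r => ->; congr cis.
  by rewrite -{2}[d]opprK -(ltz0_abs d_lt0) mulrNz; field.
have := subrX1 (cis e) N.
rewrite -cisMn Ee divfK //.
have -> : cis (2 * pi * d%:~R : R) = 1.
  have [d_ge0|d_lt0] := leP 0 d; first by rewrite -(gez0_abs d_ge0) cis2pi.
  have := cisD R (2 * pi * d%:~R) (2 * pi * `|d|%N%:R).
  rewrite cis2pi mulr1 -mulrDr.
  rewrite -[X in X%:~R + _]opprK -(ltz0_abs d_lt0) mulrNz addNr mulr0 cis0 => <- //.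
rewrite subrr => /esym/eqP; rewrite mulf_eq0 subr_eq0 -Ee (negPf eN1) /=.
by move/eqP.
Qed.

(** The coefficient [b n0] is the average of [e^(-i n0 t) F(t)] over the [N]-th
    roots of unity once [N] exceeds all the gaps [|n - n0|], so some value of [F]
    is at least as large. *)
Lemma exp_sum_ge_coef (R : realType) (B : seq int) (b : int -> R) (n0 : int) :
    uniq B -> n0 \in B ->
  exists2 t, 0 <= t <= 2 * pi & real_complex R `|b n0| <= `|exp_sum B b t|.
Proof.
move=> uB n0B.
(* More than every gap from [n0], so that the other frequencies average out. *)
pose N := (\sum_(n <- B) `|(n - n0)%R|).+1.
pose th (j : nat) : R := 2 * pi * j%:R / N%:R.
have dN n : n \in B -> (`|(n - n0)%R| < N)%N.
  by move=> nB; rewrite ltnS (big_rem n) //= leq_addr.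
have avg : \sum_(j < N) cis (- th j * n0%:~R) * exp_sum B b (th j)
         = N%:R * real_complex R (b n0).
  rewrite /exp_sum.
  under eq_bigr => j _ do rewrite mulr_sumr.
  rewrite exchange_big (big_rem n0) //= [X in _ + X](_ : _ = 0) ?addr0.
    under eq_bigr => j _ do rewrite mulrCA -cisD mulNr addNr cis0 mulr1.
    by rewrite sumr_const card_ord mulr_natl.
  rewrite big_seq big1 // => n; rewrite mem_rem_uniq // inE => /andP[nn0 nB].
  transitivity (real_complex R (b n) * \sum_(j < N) cis (th j * (n - n0)%:~R)).
    rewrite mulr_sumr; apply: eq_bigr => j _.
    by rewrite mulrCA -cisD; congr (_ * cis _); rewrite intrB; ring.
  by rewrite sum_cis_roots ?mulr0 ?subr_eq0 ?dN.
have nb (x : R) : `|real_complex R x| = real_complex R `|x|.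
  by rewrite normc_def /= expr0n addr0 sqrtr_sqr.
have : ~ forall j : 'I_N, `|exp_sum B b (th j)| < real_complex R `|b n0|.
  move=> small; suff : `|N%:R * real_complex R (b n0)| < `|N%:R * real_complex R (b n0)|.
    by rewrite ltxx.
  rewrite [ltRHS]normrM normr_nat nb -avg.
  apply: (@le_lt_trans _ _ (\sum_(j < N) `|exp_sum B b (th j)|)).
    apply: le_trans (ler_norm_sum _ _ _) _; apply: ler_sum => j _.
    by rewrite normrM norm_cis mul1r.
  rewrite mulr_natl -[X in _ *+ X]card_ord -sumr_const.
  apply: ltr_sum => [|j _]; last exact: small.
  by apply/hasP; exists ord0 => //; exact: mem_index_enum.
move=> /existsNP [j big]; exists (th j).
  have N0 : 0 < (N%:R : R) by rewrite ltr0n.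
  rewrite /th divr_ge0 ?mulr_ge0 ?pi_ge0 //= -[leLHS]mulrA ler_piMr ?mulr_ge0 ?pi_ge0 //.
  by rewrite ler_pdivrMr // mul1r ler_nat ltnW.
rewrite real_leNgt ?normr_real //; first by apply/negP.
by rewrite complex_real.
Qed.

(** * Lower bound for the l^1 norm of a difference *)

(** The factor by which a difference multiplies an exponential sum has modulus
    [2 - O(x^2)] at distance [x] from [pi]; the quadratic error is what allows
    distances of order [k ^ (-1/2)] in a [k]-th power. *)
Lemma norm_cis_sub1_near_pi (R : realType) (x y : R) : `|x| <= y ->
  real_complex R (Num.sqrt (4 - y ^+ 2)) <= `|cis (- (pi + x)) - 1|.
Proof.
move=> xy; rewrite norm_cis_sub1 lecR ler_wsqrtr // cosN (addrC pi) cosDpi.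
have : x ^+ 2 <= y ^+ 2.
  by rewrite -(real_normK (num_real x)) lerXn2r ?nnegrE // (le_trans _ xy).
have := cos_ge R x.
by move: (cos x) (x ^+ 2) (y ^+ 2) => c x2 y2; lra.
Qed.

(** Transport of a value of an exponential sum from [t] to the neighbourhood of
    [pi], at a cost independent of the frequencies in [B]. *)
Lemma exp_sum_interpolation (R : realType) (B : seq int) (b : int -> R) (L : nat) (t : R) :
  exists2 c : nat -> R[i],
    \sum_(i < size B) `|c i| <= (turan_bound L (size B))%:R &
    exp_sum B b t =
      \sum_(i < size B) c i * exp_sum B b (pi + i%:R * ((pi - t) / L.+1%:R)).
Proof.
set h := _ / _.
have hL : t + h * L.+1%:R = pi by rewrite divfK ?pnatr_eq0 // addrC subrK.
have [z|Q [QS QE QB]] := @unit_interpolation _ [seq cis (h * n%:~R) | n <- B] L.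
  by move=> /mapP[n _ ->]; exact: norm_cis.
rewrite size_map in QS QB; exists (fun i => Q`_i) => //.
rewrite /exp_sum; under [RHS]eq_bigr do rewrite mulr_sumr.
rewrite exchange_big /= !big_seq; apply: eq_bigr => n nB.
transitivity (real_complex R (b n) * cis (t * n%:~R)
   * (Q.[cis (h * n%:~R)] * cis (h * n%:~R) ^+ L.+1)).
  by rewrite QE ?mulr1 //; apply/mapP; exists n.
rewrite (horner_coef_wide _ QS) mulr_suml mulr_sumr; apply: eq_bigr => i _.
rewrite -!cisMn -hL.
have -> : (t + h * L.+1%:R + i%:R * h) * n%:~R
  = t * n%:~R + (h * n%:~R * i%:R + h * n%:~R * L.+1%:R) by ring.
by rewrite !cisD; ring.
Qed.

(** A value of modulus at least [1] of the exponential sum is a combination of its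
    values at points [pi + i h], with coefficients of total size at most
    [turan_bound L m]; and each of these values, multiplied by the [k]-th power
    of the chord, is a value of the exponential sum of the difference, hence is
    at most its [l^1] norm. *)
Lemma fwd_diff_l1_ge (R : realType) (B S : seq int) (b : int -> R) (k L : nat) n0 :
    uniq B -> uniq S -> (forall n, n \notin B -> b n = 0) ->
    (forall n j, n \in B -> (j <= k)%N -> n - k%:Z + j%:Z \in S) ->
    n0 \in B -> 1 <= `|b n0| ->
  Num.sqrt (4 - ((size B).-1%:R * pi / L.+1%:R) ^+ 2) ^+ k
    <= (turan_bound L (size B))%:R * \sum_(n <- S) `|fwd_diff k b n|.
Proof.
move=> uB uS b0 BS n0B bn0; set s := Num.sqrt _; set N1 := \sum_(n <- S) _.
have [t /andP[t0 t2] Ft] := exp_sum_ge_coef R B b n0 uB n0B.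
have {}Ft : 1 <= `|exp_sum B b t| by apply: le_trans Ft; rewrite lecR.
have [c cB Fc] := exp_sum_interpolation R B b L t.
(* As [t] lies in [[0, 2 pi]], either direction of travel to [pi] is short. *)
set h := _ / _ in Fc.
have hle : `|h| <= pi / L.+1%:R.
  rewrite normrM normfV normr_nat ler_wpM2r ?invr_ge0 //.
  by rewrite ler_norml; apply/andP; split; lra.
have near (i : 'I_(size B)) :
    real_complex R s ^+ k * `|exp_sum B b (pi + i%:R * h)| <= real_complex R N1.
  apply: le_trans (exp_sum_norm_le R S (fwd_diff k b) (pi + i%:R * h)).
  rewrite (exp_sum_fwd_diff R B) // normrM normrX ler_wpM2r //.
  rewrite lerXn2r ?nnegrE ?normr_ge0 ?ler0c ?sqrtr_ge0 //.
  apply: norm_cis_sub1_near_pi; rewrite normrM normr_nat -mulrA.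
  have := ltn_ord i => iB.
  apply: ler_pM => //; rewrite ler_nat -ltnS; lia.
rewrite -(@lecR R) rmorphXn rmorphM rmorph_nat.
have s0 : 0 <= real_complex R s ^+ k by rewrite exprn_ge0 // ler0c sqrtr_ge0.
apply: (@le_trans _ _ (real_complex R s ^+ k * `|exp_sum B b t|)).
  by rewrite ler_peMr.
rewrite Fc.
apply: (@le_trans _ _ (real_complex R s ^+ k *
   \sum_(i < size B) `|c i| * `|exp_sum B b (pi + i%:R * h)|)).
  rewrite ler_wpM2l // (le_trans (ler_norm_sum _ _ _)) //.
  by apply: ler_sum => i _; rewrite normrM.
rewrite mulr_sumr.
apply: (@le_trans _ _ (\sum_(i < size B) `|c i| * real_complex R N1)).
  by apply: ler_sum => i _; rewrite mulrCA ler_wpM2l.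
rewrite -mulr_suml ler_wpM2r // ler0c.
by rewrite /N1 sumr_ge0.
Qed.

(** * Choice of the progression *)

Lemma bin_fact_le n m : ('C(n, m) * m`! <= n ^ m)%N.
Proof.
rewrite bin_ffact; elim: m n => [|m IH] n; first by rewrite ffactn0.
rewrite ffactnS expnS leq_mul //; case: n => [|n] /=; last first.
  by apply: leq_trans (IH n) _; case: (m) => // m'; rewrite leq_exp2r.
by case: m {IH} => //= m; rewrite ffact0n.
Qed.

(** All binomials are bounded by the last one, and the powers of two sum
    to less than [2 ^ (M + 1)]. *)
Lemma turan_bound_le L M : (turan_bound L M.+1 * M`! <= 2 * (2 * (L + M)) ^ M)%N.
Proof.
apply: (@leq_trans (2 ^ M.+1 * 'C(L + M, M) * M`!)%N).
  rewrite leq_mul2r; apply/orP; right.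
  apply: (@leq_trans (\sum_(i < M.+1) 'C(L + M, M) * 2 ^ i)%N).
    apply: leq_sum => i _; rewrite leq_mul2r; apply/orP; right.
    have := ltn_ord i; rewrite ltnS => iM.
    have E j : 'C(L + j, j) = 'C(L + j, L) by rewrite -bin_sub ?leq_addl ?addnK.
    by rewrite !E leq_bin2l // leq_add2l.
  rewrite -big_distrr /= mulnC leq_mul2r; apply/orP; right.
  have -> : (\sum_(i < M.+1) 2 ^ i = (2 ^ M.+1).-1)%N by rewrite predn_exp mul1n.
  exact: leq_pred.
by rewrite expnS expnMn -!mulnA leq_mul2l /= leq_mul2l bin_fact_le orbT.
Qed.

Lemma pow_le_expR_fact (R : realType) (M : nat) :
  (M%:R ^+ M : R) <= expR M%:R * M`!%:R.
Proof.
case: M => [|M]; first by rewrite expR0 mul1r.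
rewrite -ler_pdivrMr ?ltr0n ?fact_gt0 //.
apply: le_trans (expR_ge1Dxn M (ler0n R M.+1)).
by rewrite lerDr.
Qed.

(** The only numerical comparison between the constant obtained here and the
    constant [7 pi e^(3/2)]; the crude bounds [pi >= 2], [sqrt 2 >= 7 / 5] and
    [e^(1/4) <= 4 / 3] suffice. *)
Lemma sqrt_e_le_pi_sqrt2 (R : realType) :
  10 * expR (1 / 2) <= 7 * pi * Num.sqrt 2 :> R.
Proof.
have e : expR (1 / 2) <= 16 / 9 :> R.
  have h : 3 / 4 <= expR (- (1 / 4)) :> R by apply: le_trans (expR_ge1Dx _); lra.
  have -> : 1 / 2 = 1 / 4 + 1 / 4 :> R by lra.
  move: h; rewrite expRN expRD.
  have := expR_gt0 (1 / 4 : R); move: (expR _) => x x0 h.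
  have {h} : x <= 4 / 3.
    by move: h; rewrite -(ler_pM2r x0) mulVf ?gt_eqF //; lra.
  nra.
have s : 7 / 5 <= Num.sqrt 2 :> R by rewrite -[leLHS]gtr0_norm ?divr_gt0 // -sqrtr_sqr ler_wsqrtr //; lra.
have := pi_ge2 R.
move: (expR _) (Num.sqrt 2) pi e s => x y z; nra.
Qed.

(** With [u = 4 M^2 / (L + 1)^2] and [pi <= 4], the chord is at least
    [2 sqrt (1 - u)], and [1 - u >= e^(-2u)] because [u <= 1/4]; the condition
    on [L] says that [u k <= M]. *)
Lemma chord_pow_ge (R : realType) (M k L : nat) :
    (4 * M <= k)%N -> (4 * k * M <= L.+1 ^ 2)%N ->
  2 ^+ k * expR (- M%:R) <= Num.sqrt (4 - (M%:R * pi / L.+1%:R) ^+ 2) ^+ k :> R.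
Proof.
move=> Mk kL; set l : R := L.+1%:R.
have l0 : 0 < l by rewrite ltr0n.
have kL' : 4 * k%:R * M%:R <= l ^+ 2 by rewrite -natrX -!natrM ler_nat.
have Mk' : 4 * M%:R <= k%:R :> R by rewrite -natrM ler_nat.
have M0 : 0 <= M%:R :> R by [].
pose u : R := 4 * M%:R ^+ 2 / l ^+ 2.
have u0 : 0 <= u by rewrite divr_ge0 ?mulr_ge0 ?exprn_ge0 // ltW.
have uk : u * k%:R <= M%:R.
  rewrite /u mulrAC ler_pdivrMr ?exprn_gt0 //.
  move: kL' M0; move: (M%:R) (k%:R) (l ^+ 2) => a b c; nra.
have u4 : u <= 1 / 4.
  rewrite /u ler_pdivrMr ?exprn_gt0 //.
  move: kL' M0 Mk'; move: (M%:R) (k%:R) (l ^+ 2) => a b c; nra.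
have s_ge : 2 * expR (- u) <= Num.sqrt (4 - (M%:R * pi / l) ^+ 2).
  have e0 := expR_gt0 (- u).
  rewrite -[leLHS]gtr0_norm ?mulr_gt0 // -sqrtr_sqr ler_wsqrtr //.
  have pl : (M%:R * pi / l) ^+ 2 <= 4 * u.
    rewrite /u mulrA expr_div_n ler_wpM2r ?invr_ge0 ?exprn_ge0 ?(ltW l0) // exprMn.
    have : pi ^+ 2 <= 16 :> R.
      have := pi_ge0 R; have := @pihalf_lt2 R; move: pi => x; nra.
    by move: (pi ^+ 2) (M%:R ^+ 2) (exprn_ge0 2 M0) => a b; nra.
  have eu : expR (- u) ^+ 2 * (1 + 2 * u) <= 1.
    rewrite -expRM_natl mulrN expRN mulrC ler_pdivrMr ?expR_gt0 // mul1r.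
    exact: expR_ge1Dx.
  move: (_ ^+ 2) pl => v pl.
  rewrite exprMn; move: (expR (- u) ^+ 2) (exprn_gt0 2 e0) eu => e e_0 eu.
  have : e <= 1 - u by nra.
  by lra.
apply: (@le_trans _ _ ((2 * expR (- u)) ^+ k)).
  rewrite exprMn ler_wpM2l ?exprn_ge0 // -expRM_natr ler_expR.
  by rewrite mulNr lerN2.
by rewrite lerXn2r ?nnegrE ?sqrtr_ge0 // mulr_ge0 // expR_ge0.
Qed.

(** Combines [turan_bound_le] with [M^M <= e^M M!]. Since [M] is at most half of
    [sqrt (k M)], the base [2 (L + M)] is at most [5 sqrt (k M)]. *)
Lemma turan_bound_le_real (R : realType) (M k L : nat) :
    (4 * M <= k)%N -> L%:R <= 2 * Num.sqrt (k%:R * M%:R) :> R ->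
  (turan_bound L M.+1)%:R * M%:R ^+ M
    <= 2 * (5 * expR 1 * Num.sqrt (k%:R * M%:R)) ^+ M :> R.
Proof.
move=> Mk LkM; set w := Num.sqrt _ in LkM *.
have w0 : 0 <= w by rewrite sqrtr_ge0.
have Mw : 2 * M%:R <= w.
  rewrite -[leLHS]ger0_norm // -sqrtr_sqr ler_wsqrtr //.
  by rewrite -[2]/(2%:R) -!natrM -natrX ler_nat; nia.
apply: (@le_trans _ _ ((turan_bound L M.+1 * M`!)%:R * expR M%:R)).
  by rewrite natrM -mulrA ler_wpM2l // mulrC pow_le_expR_fact.
rewrite mulrAC exprMn -expRM_natr mul1r mulrA ler_wpM2r ?expR_ge0 //.
apply: (@le_trans _ _ (2 * (2 * (L + M)) ^ M)%N%:R); first by rewrite ler_nat turan_bound_le.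
rewrite natrM natrX ler_wpM2l // lerXn2r ?nnegrE ?mulr_ge0 // natrM natrD.
by move: (L%:R) (M%:R) LkM Mw => a b; lra.
Qed.

(** [L] is the integer part of [2 sqrt (k M)]. After clearing denominators the
    inequality is an [M]-th power of a comparison of constants; the factor
    [2^k / 2] absorbs the [2] in front of the bound of the interpolation cost. *)
Lemma frequency_step_exists (R : realType) (M k : nat) :
    (0 < k)%N -> (4 * M <= k)%N -> exists L,
  M.+1%:R * (2 ^+ k / 2)
    * (Num.sqrt M%:R / (7 * pi * expR (3 / 2)) / Num.sqrt (2 * k%:R)) ^+ M
    * (turan_bound L M.+1)%:R
  <= Num.sqrt (4 - (M%:R * pi / L.+1%:R) ^+ 2) ^+ k :> R.
Proof.
move=> k0 Mk; pose w : R := Num.sqrt (k%:R * M%:R).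
have w0 : 0 <= 2 * w by rewrite mulr_ge0 ?sqrtr_ge0.
pose L := Num.truncn (2 * w); exists L.
have /andP[Lw wL] := truncn_itv w0.
have kL : (4 * k * M <= L.+1 ^ 2)%N.
  rewrite -(ler_nat R) natrX !natrM.
  have -> : 4 * k%:R * M%:R = (2 * w) ^+ 2 :> R.
    by rewrite exprMn sqr_sqrtr ?mulr_ge0 //; ring.
  by rewrite lerXn2r ?nnegrE // ltW.
apply: le_trans (chord_pow_ge R M k L Mk kL).
have [->|M_gt0] := posnP M.
  rewrite oppr0 expR0 expr0 /turan_bound big_ord1 bin0 expn0 !mulr1 mul1r.
  by rewrite ler_pdivrMr // ler_peMr ?exprn_ge0 // ler1n.
have M0 : 0 < M%:R :> R by rewrite ltr0n.
have kR0 : 0 < k%:R :> R by rewrite ltr0n.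
have T := turan_bound_le_real R M k L Mk Lw.
set X := _ / (7 * pi * _) / _; set t := (turan_bound L M.+1)%:R.
have X0 : 0 <= X by rewrite !divr_ge0 ?sqrtr_ge0 ?mulr_ge0 ?pi_ge0 ?expR_ge0.
suff main : M.+1%:R * X ^+ M * t <= 2 * expR (- M%:R).
  have -> : M.+1%:R * (2 ^+ k / 2) * X ^+ M * t
          = 2 ^+ k / 2 * (M.+1%:R * X ^+ M * t) by ring.
  apply: le_trans (ler_wpM2l _ main) _; first by rewrite divr_ge0 ?exprn_ge0.
  by rewrite mulrA divfK.
(* The factor [m] of the target; it is paid by a factor [2] in each power. *)
have M2 : M.+1%:R <= 2 ^+ M :> R by rewrite -natrX ler_nat ltn_expl.
rewrite -(ler_pM2r (exprn_gt0 M M0)) -[leLHS]mulrA.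
apply: (@le_trans _ _ (2 ^+ M * X ^+ M * (2 * (5 * expR 1 * w) ^+ M))).
  by rewrite ler_pM ?mulr_ge0 ?exprn_ge0 ?ler0n // ler_wpM2r ?exprn_ge0.
have -> : expR (- M%:R) = expR (- 1) ^+ M :> R by rewrite -expRM_natr mulN1r.
rewrite [leLHS]mulrCA -[leRHS]mulrA -!exprMn.
have base_ge0 : 0 <= 2 * X * (5 * expR 1 * w).
  by rewrite mulr_ge0 ?(mulr_ge0 _ X0) // !mulr_ge0 ?expR_ge0 ?sqrtr_ge0.
rewrite ler_wpM2l // lerXn2r ?nnegrE // ?mulr_ge0 ?expR_ge0 //.
have -> : 2 * X * (5 * expR 1 * w)
    = M%:R * (10 * expR (1 / 2)) / (7 * pi * Num.sqrt 2) * expR (- 1).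
  have sM : M%:R = Num.sqrt M%:R ^+ 2 :> R by rewrite sqr_sqrtr.
  rewrite /X /w !sqrtrM // [in RHS]sM.
  have -> : expR (3 / 2) = expR (1 / 2) * expR 1 :> R by rewrite -expRD; congr expR; lra.
  have -> : expR 1 = expR (1 / 2) ^+ 2 :> R by rewrite -expRM_natr; congr expR; lra.
  have -> : expR (-1) = (expR (1 / 2) ^+ 2)^-1 :> R.
    by rewrite -expRM_natr -expRN; congr expR; lra.
  have sk : Num.sqrt k%:R != 0 :> R by rewrite gt_eqF // sqrtr_gt0.
  have s2 : Num.sqrt 2 != 0 :> R by rewrite gt_eqF // sqrtr_gt0.
  have p0 : pi != 0 :> R by rewrite gt_eqF // pi_gt0.
  have e0 : expR (1 / 2) != 0 :> R by rewrite gt_eqF // expR_gt0.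
  move: p0; move: pi => c c0.
  by field; rewrite s2 sk c0 e0.
rewrite mulrC ler_wpM2l ?expR_ge0 // -mulrA ler_piMr //.
rewrite ler_pdivrMr ?mulr_gt0 ?pi_gt0 ?sqrtr_gt0 // [leRHS]mul1r.
exact: sqrt_e_le_pi_sqrt2.
Qed.

(** * The l^p norms of functions on the integers *)

Lemma counting_seq (R : realType) (S : {fset int}) :
  counting [set` S] = (#|` S|%:R%:E : \bar R).
Proof. by rewrite /counting asboolT ?fset_setK ?set_fsetK //; exact: finite_fset. Qed.

(** The right-hand side is bounded below by the integral of the combination of
    indicators of singletons that agrees with [f] on [S] and vanishes elsewhere. *)
Lemma sum_le_integral_counting (R : realType) (S : {fset int}) (f : int -> R) :
  (forall n, 0 <= f n) ->
  ((\sum_(n <- S) f n)%:E <= \int[@counting int R]_n (f n)%:E)%E.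
Proof.
move=> f0.
have -> : ((\sum_(n <- S) f n)%:E =
   \int[@counting int R]_n \sum_(m <- S) ((f m)%:E * (\1_[set m] n)%:E))%E.
  rewrite ge0_integral_sum //; last first.
    by move=> m n _; rewrite mule_ge0 ?lee_fin.
  rewrite -sumEFin; apply: eq_bigr => m _.
  rewrite ge0_integralZl //; last by rewrite lee_fin.
  rewrite integral_indic // setIT /= (_ : [set m] = [set` [fset m]]).
    by rewrite counting_seq cardfs1 mule1.
  by apply/seteqP; split => x /=; rewrite inE => /eqP.
apply: ge0_le_integral => //.
- by move=> n _; apply: sume_ge0 => m _; rewrite mule_ge0 ?lee_fin.
- move=> n _.
  have [nS|nS] := boolP (n \in S).
    rewrite (big_fsetD1 n) //= indicE mem_set // mule1 big_seq big1 ?adde0 //.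
    move=> m; rewrite in_fsetD1 => /andP[mn _]; rewrite indicE memNset ?mule0 //.
    by move=> /= nm; rewrite nm eqxx in mn.
  rewrite big_seq big1 ?lee_fin // => m mS; rewrite indicE memNset ?mule0 //.
  by move=> /= nm; rewrite nm mS in nS.
Qed.

Lemma inv_hoelder_conjugate (R : realType) (p : \bar R) : (1 <= p)%E ->
  fine (hoelder_conjugate p)^-1%E = 1 - fine p^-1%E.
Proof.
case: p => [r| |] //; last by rewrite hoelder_conjugatey inve1 invey subr0.
rewrite lee_fin => r1; have r0 : r != 0 by rewrite gt_eqF // (lt_le_trans _ r1).
have := @hoelder_conjugate_eq1 R r%:E (ltNyr _) r0.
rewrite inver (negPf r0) /=.
by case: (_^-1)%E => [x| |] //= [] <-; rewrite addrAC subrr add0r.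
Qed.

(** Singletons have positive counting measure, so null sets are empty. *)
Lemma ae_counting (R : realType) (P : int -> Prop) :
  (\forall n \ae @counting int R, P n) -> forall n, P n.
Proof.
move=> [A [_ A0 PA]] n; apply: contrapT => Pn.
have : (@counting int R [set` [fset n]] <= @counting int R A)%E.
  apply: (le_measure (@counting int R)); rewrite ?inE //.
  by move=> m /=; rewrite inE => /eqP ->; exact: PA.
by rewrite counting_seq cardfs1 (A0 : @counting int R A = 0%E) lee_fin ler10.
Qed.

Lemma Lnorm_indic (R : realType) (S : {fset int}) (q : R) : 0 < q ->
  Lnorm (@counting int R) q%:E (EFin \o \1_[set` S]) = (#|` S|%:R `^ q^-1)%:E.
Proof.
move=> q0; rewrite unlock -poweR_EFin -counting_seq.
rewrite -[X in counting X]setIT -integral_indic //; congr (_ `^ _)%E.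
apply: eq_integral => n _ /=; rewrite indicE.
by case: (_ \in _); rewrite /= ?normr1 ?powR1 ?normr0 ?powR0 ?gt_eqF.
Qed.

(** Hoelder's inequality against the indicator of [S]; the endpoints [p = 1] and
    [p = +oo] are treated directly. *)
Lemma l1_le_lp_norm (R : realType) (S : {fset int}) (g : int -> R) (p : \bar R) :
    (1 <= p)%E ->
  ((\sum_(n <- S) `|g n|)%:E <=
    lp_norm p g * (#|` S|%:R `^ fine (hoelder_conjugate p)^-1%E)%:E)%E.
Proof.
move=> p1; rewrite inv_hoelder_conjugate //; case: p p1 => [r| |] // r1; last first.
  rewrite invey subr0 powRr1 // /lp_norm Lnorm.unlock.
  have T0 : (0 < @counting int R [set: int])%E.
    apply: (@lt_le_trans _ _ (@counting int R [set` [fset (0 : int)]])).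
      by rewrite counting_seq cardfs1 lte_fin.
    by apply: le_measure; rewrite ?inE.
  rewrite ifT //.
  set M := ess_sup _ _.
  have gM n : (`|g n|%:E <= M)%E.
    exact: (@ae_counting R _ (ess_sup_ge (@counting int R) (abse \o (EFin \o g)))).
  have M0 : (0 <= M)%E by apply: le_trans (gM 0); rewrite lee_fin.
  case: M gM M0 => [M gM M0| gM _|//]; last first.
    have [->|S0] := eqVneq S fset0; first by rewrite big_seq_fset0 cardfs0 mule0.
    by rewrite gt0_mulye ?leey // lte_fin ltr0n cardfs_gt0.
  rewrite lee_fin; apply: (@le_trans _ _ (\sum_(n <- S) M)).
    by apply: ler_sum => n _; rewrite -lee_fin gM.
  by rewrite big_const_seq count_predT iter_addr_0 mulr_natr.
rewrite lee_fin in r1; have [r_eq1|r_neq1] := eqVneq r 1.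
  rewrite r_eq1 inve1 subrr powRr0 mule1 /lp_norm Lnorm1.
  exact: sum_le_integral_counting.
have r_gt1 : 1 < r by rewrite lt_neqAle eq_sym r_neq1.
have r0 : 0 < r by rewrite (lt_trans ltr01).
have q0 : 0 < (1 - r^-1)^-1 by rewrite invr_gt0 subr_gt0 invf_lt1.
rewrite inver gt_eqF // /=.
have := @hoelder _ int R (@counting int R) g \1_[set` S] r (1 - r^-1)^-1.
have mf (f : int -> R) : measurable_fun [set: int] f by [].
move=> /(_ (mf _) (mf _) r0 q0).
rewrite invrK addrC subrK => /(_ erefl); rewrite Lnorm_indic // invrK; apply: le_trans.
rewrite Lnorm1.
apply: (@le_trans _ _ (\sum_(n <- S) `|(g \* \1_[set` S]) n|)%:E); last first.
  exact: sum_le_integral_counting.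
rewrite lee_fin big_seq [leRHS]big_seq; apply: ler_sum => n nS.
by rewrite /= indicE mem_set // mulr1.
Qed.

(** * From the l^1 bound to the l^p bound *)

(** The power of [2] with a logarithm in its exponent is
    [2^(k-1) / sqrt (2k)^M]. *)
Lemma diff_lower_boundE (R : realType) (p : \bar R) (M k : nat) : (0 < k)%N ->
  diff_lower_bound p M.+1 k =
    2 ^+ k / 2 * (Num.sqrt M%:R / (7 * pi * expR (3 / 2)) / Num.sqrt (2 * k%:R)) ^+ M
    * (k%:R + 1) `^ (- fine (hoelder_conjugate p)^-1%E) * M.+1%:R `^ fine p^-1%E.
Proof.
move=> k0; rewrite /diff_lower_bound; do 2 congr (_ * _).
have -> : M.+1%:R - 1 = M%:R :> R by rewrite -natr1 addrK.
have k20 : 0 < 2 * k%:R :> R by rewrite mulr_gt0 ?ltr0n.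
rewrite [X in _ = _ * X]expr_div_n [RHS]mulrA [RHS]mulrAC; congr (_ * _).
rewrite -addrA powRD; last by rewrite pnatr_eq0 implybT.
rewrite powR_mulrn // -[RHS]mulrA; congr (_ * _).
rewrite -opprD powRN powRD; last by rewrite pnatr_eq0 implybT.
rewrite powRr1 // invfM; congr (_ * _); congr (_^-1).
have l2 : ln 2 != 0 :> R by rewrite gt_eqF // ln_gt0 // ltr1n.
rewrite /powR pnatr_eq0 /= /log2.
have -> : M%:R / 2 * (ln (2 * k%:R) / ln 2) * ln 2 = ln (2 * k%:R) / 2 * M%:R :> R.
  by field.
rewrite expRM_natr; congr (_ ^+ _).
rewrite -[LHS]ger0_norm ?expR_ge0 // -sqrtr_sqr -expRM_natr divfK // lnK //.
Qed.

Lemma fwd_diff1 (R : realType) (f : int -> R) n : fwd_diff 1 f n = f (n + 1) - f n.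
Proof.
rewrite /fwd_diff !big_nat_recr //= big_geq // bin0 bin1 add0r subr0 expr0 expr1.
by rewrite mulr1 !mul1r mulN1r addrK.
Qed.

Lemma fwd_diffS (R : realType) (k : nat) (f : int -> R) :
  fwd_diff k.+1 f = fwd_diff k (fwd_diff 1 f).
Proof.
apply/funext => n.
pose g (j : nat) := f (n + k%:Z - j%:Z).
have -> : fwd_diff k (fwd_diff 1 f) n =
    \sum_(0 <= j < k.+1) 'C(k, j)%:R * (-1) ^+ j * f (n + k.+1%:Z - j%:Z)
    - \sum_(0 <= j < k.+1) 'C(k, j)%:R * (-1) ^+ j * g j.
  rewrite -sumrB /fwd_diff; apply: eq_bigr => j _.
  rewrite -mulrBr -/(fwd_diff 1 f _) fwd_diff1 /g; congr (_ * (f _ - _)).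
  by rewrite intS; ring.
have fg (j : nat) : f (n + k.+1%:Z - j.+1%:Z) = g j.
  by rewrite /g; congr f; rewrite !intS; ring.
rewrite /fwd_diff big_nat_recl // [in RHS]big_nat_recl // !bin0.
rewrite -[RHS]addrA; congr (_ + _).
under eq_bigr do rewrite fg binS natrD !mulrDl.
under [X in _ = X - _]eq_bigr do rewrite fg.
rewrite big_split /=; congr (_ + _).
  by rewrite big_nat_recr //= bin_small // !mul0r addr0.
by rewrite -sumrN; apply: eq_bigr => j _; rewrite exprS mulN1r mulrN mulNr.
Qed.

Lemma fine_inv_ge0 (R : realType) (q : \bar R) : (1 <= q)%E -> 0 <= fine q^-1%E.
Proof.
case: q => [r| |]; [| by rewrite invey | by []].
rewrite lee_fin => r1; have r0 : 0 < r by rewrite (lt_le_trans ltr01).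
by rewrite inver gt_eqF //= invr_ge0 ltW.
Qed.

(** The value of a function at [n] enters its difference of order [k] exactly at
    the [k + 1] points [n - k + j], [j <= k]. *)
Lemma fwd_diff_window (B : {fset int}) (k : nat) :
  exists S : {fset int},
    (forall n j, n \in B -> (j <= k)%N -> n - k%:Z + j%:Z \in S) /\
    (#|` S| <= k.+1 * #|` B|)%N.
Proof.
exists (seq_fset tt [seq n - k%:Z + j%:Z | n <- B, j <- iota 0 k.+1]); split.
  move=> n j nB jk; rewrite seq_fsetE; apply/allpairsP.
  by exists (n, j); split => //; rewrite mem_iota.
rewrite size_seq_fset (leq_trans (size_undup _)) // size_allpairs size_iota mulnC //.
Qed.

(** With [a = 1 / p'], the [l^1] bound is [m Y <= sum |fwd_diff k b|] and
    Hoelder's inequality loses [((k + 1) m)^a]; the power [m^(1 - a) = m^(1/p)]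
    of the target is what remains of the factor [m]. *)
Lemma fwd_diff_lp_ge (R : realType) (B : {fset int}) (b : int -> R) (n0 : int)
    (k : nat) (p : \bar R) :
    (forall n, n \notin B -> b n = 0) -> n0 \in B -> 1 <= `|b n0| ->
    (4 * #|` B| <= k)%N -> (1 <= p)%E ->
  ((diff_lower_bound p #|` B| k)%:E <= lp_norm p (fwd_diff k b))%E.
Proof.
move=> b0 n0B bn0 Bk p1.
have B0 : (0 < #|` B|)%N by rewrite cardfs_gt0; apply/fset0Pn; exists n0.
have k0 : (0 < k)%N by lia.
have [S [BS cardS]] := fwd_diff_window B k.
have [M BM] : exists M, #|` B| = M.+1 by exists #|` B|.-1; rewrite prednK.
have [||L step] := frequency_step_exists R M k; [lia|lia|].
have := fwd_diff_l1_ge R B S b k L n0 (fset_uniq B) (fset_uniq S) b0 BS n0B bn0.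
have -> : size B = M.+1 by [].
rewrite -pred_Sn => l1; rewrite diff_lower_boundE //.
have := l1_le_lp_norm R S (fwd_diff k b) p p1.
have := inv_hoelder_conjugate R p p1.
have a0 := fine_inv_ge0 R _ (hoelder_conj_ge1 p1).
move: a0; set a := fine (hoelder_conjugate p)^-1%E => a0 aE.
have -> : fine p^-1%E = 1 - a by rewrite aE opprB addrC subrK.
set Y := 2 ^+ k / 2 * _; set N1 := \sum_(n <- S) _ in l1 *.
have T0 : 0 < (turan_bound L M.+1)%:R :> R.
  by rewrite ltr0n /turan_bound big_ord_recl bin0.
have YN : M.+1%:R * Y <= N1.
  rewrite -(ler_pM2r T0) [leRHS]mulrC; apply: le_trans l1.
  by apply: le_trans step; rewrite /Y mulrA.
have [k1 M1] : 0 < k%:R + 1 :> R /\ 0 < M.+1%:R :> R by rewrite natr1 !ltr0n.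
have Sa : #|` S|%:R `^ a <= (k%:R + 1) `^ a * M.+1%:R `^ a.
  rewrite -powRM ?(ltW k1) ?(ltW M1) //; apply: ge0_ler_powR; rewrite ?nnegrE ?mulr_ge0 ?(ltW k1) //.
  by rewrite natr1 -natrM ler_nat -BM.
have lp0 : (0 <= lp_norm p (fwd_diff k b))%E by exact: Lnorm_ge0.
move: lp0; case: (lp_norm p _) => [r r0 | _ _ |//]; last exact: leey.
rewrite -EFinM !lee_fin => N1r.
rewrite lee_fin in r0.
rewrite powRD ?(gt_eqF M1) ?implybT // powRr1 ?(ltW M1) // !powRN.
rewrite (_ : Y * _ * _ = M.+1%:R * Y / ((k%:R + 1) `^ a * M.+1%:R `^ a)); last first.
  by rewrite invfM; ring.
rewrite ler_pdivrMr ?mulr_gt0 ?powR_gt0 //.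
apply: le_trans YN _; apply: le_trans N1r _; exact: ler_wpM2l.
Qed.

(** * Characteristic functions and boundaries *)

Definition right_boundary (A : {fset int}) : {fset int} :=
  [fset n in A | n + 1 \notin A].

(** Translation by [-1] maps the points of [A] with a left neighbour in [A] onto
    those with a right neighbour in [A]. *)
Lemma card_right_boundary (A : {fset int}) : #|` right_boundary A| = #|` left_boundary A|.
Proof.
have lE : left_boundary A = A `\` [fset n in A | (n - 1)%R \in A].
  by apply/fsetP => n; rewrite !inE /=; case: (n \in A); case: (n - 1 \in A).
have rE : right_boundary A = A `\` [fset n in A | (n + 1)%R \in A].
  by apply/fsetP => n; rewrite !inE /=; case: (n \in A); case: (n + 1 \in A).
rewrite lE rE !cardfsDS; try by apply/fsubsetP => n; rewrite !inE => /andP[].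
congr (_ - _)%N.
have -> : [fset n in A | (n + 1)%R \in A] =
    [fset (n - 1)%R | n in [fset n in A | (n - 1)%R \in A]]; last first.
  by rewrite card_imfset //= => x y; lia.
apply/fsetP => n; apply/idP/imfsetP => /= [|[m]].
  rewrite !inE => /andP[nA n1A]; exists (n + 1); last by rewrite addrK.
  by rewrite !inE addrK n1A.
by rewrite !inE => /andP[mA m1A] ->; rewrite subrK m1A.
Qed.

(** Otherwise [A] would contain an infinite descending progression. *)
Lemma left_boundary_neq0 (A : {fset int}) : A != fset0 -> left_boundary A != fset0.
Proof.
case/fset0Pn => a aA; apply/eqP => l0.
have down n : n \in A -> n - 1 \in A.
  move=> nA; apply: contraT => n1A.
  suff : n \in left_boundary A by rewrite l0.
  by rewrite !inE nA n1A.
have all_below (i : nat) : a - i%:Z \in A.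
  elim: i => [|i IH]; first by rewrite subr0.
  by rewrite (_ : a - i.+1%:Z = a - i%:Z - 1) ?down //; rewrite intS; ring.
have : (#|` A|.+1 <= #|` A|)%N; last by rewrite ltnn.
have u : uniq [seq a - i%:Z | i <- iota 0 #|` A|.+1].
  by rewrite map_inj_uniq ?iota_uniq // => i j; lia.
rewrite -{1}(size_iota 0 #|` A|.+1) -(size_map (fun i : nat => a - i%:Z)).
by apply: (uniq_leq_size u) => _ /mapP[i _ ->]; exact: all_below.
Qed.

(** The support of the first difference of the characteristic function: it is
    [1] just before a left boundary point and [-1] at a right boundary point. *)
Definition step_points (A : {fset int}) : {fset int} :=
  [fset n - 1 | n in left_boundary A] `|` right_boundary A.

Lemma card_step_points (A : {fset int}) : #|` step_points A| = (2 * #|` left_boundary A|)%N.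
Proof.
rewrite cardfsU (_ : _ `&` _ = fset0) ?cardfs0 ?subn0.
  rewrite card_imfset /=; last by move=> x y /=; lia.
  by rewrite card_right_boundary mul2n addnn.
apply/fsetP => n; rewrite !inE; apply/negP => /andP[/imfsetP[m /=]].
by rewrite !inE => /andP[mA m1A] -> /andP[m1A' _]; rewrite m1A' in m1A.
Qed.

Lemma char_funE (R : realType) (A : {fset int}) n : char_fun R A n = (n \in A)%:R.
Proof. by rewrite /char_fun indicE; congr (nat_of_bool _)%:R; apply/idP/idP; rewrite inE. Qed.

Lemma in_step_points (A : {fset int}) n : (n \in step_points A) = ((n + 1 \in A) != (n \in A)).
Proof.
rewrite !inE; have -> : (n \in [fset m - 1 | m in left_boundary A]) = (n + 1 \in left_boundary A).
  apply/imfsetP/idP => /= [[m mA ->]|nA]; first by rewrite subrK.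
  by exists (n + 1); rewrite ?addrK.
by rewrite !inE addrK; case: (n \in A); case: (n + 1 \in A).
Qed.

Theorem theorem3 (R : realType) :
  (forall m : nat, exists K : nat,
     forall (A : {fset int}) (p : \bar R),
       A != fset0 -> #|` A| = m -> (1 <= p)%E ->
       forall k : nat, (K <= k)%N ->
         ((diff_lower_bound p #|` A| k)%:E
            <= lp_norm p (fwd_diff k (char_fun R A)))%E)
  /\
  (forall m : nat, exists K : nat,
     forall (A : {fset int}) (p : \bar R),
       A != fset0 -> #|` left_boundary A| = m -> (1 <= p)%E ->
       forall k : nat, (K <= k)%N ->
         ((diff_lower_bound p (2 * #|` left_boundary A|) k)%:E
            <= lp_norm p (fwd_diff k.+1 (char_fun R A)))%E).
Proof.
split=> m.
  exists (4 * m)%N => A p /fset0Pn[a aA] Am p1 k mk.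
  apply: (fwd_diff_lp_ge R A _ a) => //; last by rewrite Am.
    by move=> n nA; rewrite char_funE (negPf nA).
  by rewrite char_funE aA normr1.
exists (8 * m)%N => A p A0 Am p1 k mk.
have /fset0Pn[a aA] := left_boundary_neq0 A A0.
rewrite fwd_diffS -card_step_points.
have stepE n : fwd_diff 1 (char_fun R A) n = (n + 1 \in A)%:R - (n \in A)%:R.
  by rewrite fwd_diff1 !char_funE.
apply: (fwd_diff_lp_ge R _ _ (a - 1)) => //.
- move=> n; rewrite in_step_points negbK stepE => /eqP ->; exact: subrr.
- rewrite in_step_points subrK; move: aA; rewrite !inE => /andP[-> /negPf ->] //.
- rewrite stepE subrK; move: aA; rewrite !inE => /andP[-> /negPf ->].
  by rewrite subr0 normr1.
- by rewrite card_step_points Am mulnA.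
Qed.
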